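(* Let $G$ be a finite group and let $p$ be an odd prime. Then $s_p(G)=|G|-2$ if and only if either $G$ is isomorphic to the direct product of $C_2$ with a group of exponent $p$, or $p\equiv 2\pmod 3$ and $G\cong C_3$.
   Context: Let $G$ be a finite group and $k\geq 2$ an integer. A subset $X\subseteq G$ is called $k$-power-avoiding if $\{g,g^k\}\not\subseteq X$ for every $g\in G$ (in particular, $X$ contains no element $g$ with $g^k=g$). Define $s_k(G)=\max\{|X| : X\subseteq G \text{ is } k\text{-power-avoiding}\}$; $s_p(G)$ is the case $k=p$. $C_n$ denotes the cyclic group of order $n$. *)

(* Defs.v *)
From HB Require Import structures.
From mathcomp Require Import all_boot all_order all_algebra all_fingroup all_solvable.

Set Implicit Arguments.
Unset Strict Implicit.
Unset Printing Implicit Defensive.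

Import GroupScope.

Definition power_avoiding (gT : finGroupType) (k : nat) (G : {group gT})
    (X : {set gT}) : bool :=
  (X \subset G) && [forall g in G, ~~ ([set g; g ^+ k] \subset X)].

Definition max_power_avoiding (gT : finGroupType) (k : nat) (G : {group gT}) : nat :=
  \max_(X : {set gT} | power_avoiding k G X) #|X|.

(* A group is said to be of exponent p when x ^+ p = 1 for all of its elements
   x. The trivial group is therefore of exponent p. *)
Definition of_exponent (gT : finGroupType) (p : nat) (E : {group gT}) : bool :=
  exponent E %| p.

(* Main.v *)
(** Every power-avoiding set misses 1, so s_p(G) = |G| - 2 means that the
complement of a maximal one is {1, t} with t <> 1: every g outside {1, t} has
g^p in {1, t}, while some g <> 1 has g^p <> 1. If t^p = 1, such a g has order
p^2 and g^2 violates the condition. Otherwise the condition on t^-1 and t^2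
forces t^2 = 1 or t^3 = 1. If t^2 = 1, then t is central and is the only
involution, and G is the product of <t> and a Sylow p-subgroup. If t^3 = 1,
then t and t^-1 are the only elements not killed by p, and an element g killed
by p centralises t, so that gt is not killed by p, whence g = 1. *)
Require Import Defs.
From HB Require Import structures.
From mathcomp Require Import all_boot all_order all_algebra all_fingroup all_solvable.

Set Implicit Arguments.
Unset Strict Implicit.
Unset Printing Implicit Defensive.

Import GroupScope.

(** * Reduction to conditions on single elements *)

Lemma power_avoidingP (gT : finGroupType) (k : nat) (G : {group gT})
    (X : {set gT}) :
  reflect (X \subset G /\ {in G, forall g, g \in X -> g ^+ k \notin X})
          (power_avoiding k G X).
Proof.
apply: (iffP andP) => -[sXG avX]; split=> //.
  move=> g Gg Xg; have := forall_inP avX g Gg.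
  by rewrite subUset !sub1set Xg.
apply/forall_inP=> g Gg; rewrite subUset !sub1set; apply/andP=> -[Xg].
by apply/negP; apply: avX.
Qed.

Definition power_cover (gT : finGroupType) (k : nat) (G : {group gT}) (t : gT) :=
  {in G, forall g, g \in [set 1; t] \/ g ^+ k \in [set 1; t]}.

(** The first condition makes the complement of {1, t} avoiding, which bounds the maximum from
    below. The second keeps [G^#] from being avoiding, which bounds it from above, as no avoiding
    set contains 1. Adding 2 on the left rules out truncated subtraction, which would let the
    trivial group in. *)
Lemma max_power_avoiding_card_sub2P (gT : finGroupType) (k : nat)
    (G : {group gT}) :
  (max_power_avoiding k G + 2 = #|G|)%N <->
  (exists2 t, t \in G^# & power_cover k G t)
  /\ (exists2 g, g \in G^# & g ^+ k != 1).
Proof.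
have not1 X : power_avoiding k G X -> 1 \notin X.
  case/power_avoidingP=> _ avX; apply/negP=> X1.
  by have := avX _ (group1 G) X1; rewrite expg1n X1.
have av_le X : power_avoiding k G X -> #|X| <= max_power_avoiding k G.
  by move=> avX; apply: (leq_bigmax_cond (F := fun X : {set gT} => #|X|)).
split=> [eqG | [[t /setD1P[nt1 Gt] covt] [g /setD1P[ng1 Gg] ngk]]].
  split.
    have av0 : power_avoiding k G set0.
      by apply/power_avoidingP; split=> [|g _]; rewrite ?sub0set ?inE.
    have [X avX maxX] : {X | power_avoiding k G X & max_power_avoiding k G = #|X|}.
      by apply: eq_bigmax_cond; apply/card_gt0P; exists set0.
    have [sXG aX] := power_avoidingP _ _ _ avX.
    have cardD : #|G :\: X| = 2.
      by rewrite cardsDS // -eqG maxX addKn.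
    have D1 : 1 \in G :\: X by rewrite inE group1 not1.
    have /cards1P[t defD] : #|(G :\: X) :\ 1| == 1%N.
      by have := cardsD1 1 (G :\: X); rewrite D1 cardD add1n => -[<-].
    have defD1 : G :\: X = [set 1; t] by rewrite -defD setD1K.
    have : t \in (G :\: X) :\ 1 by rewrite defD set11.
    rewrite !inE => /and3P[nt1 _ Gt]; exists t; first by rewrite !inE nt1.
    move=> g Gg; rewrite -defD1 !inE Gg groupX // !andbT.
    by case: (boolP (g \in X)) => [/(aX g Gg)|]; [right | left].
  (* Otherwise every k-th power is 1, and [G^#] is avoiding with |G| - 1 elements, one too many. *)
  case: (boolP [exists g in G^#, g ^+ k != 1]) => [/exists_inP[g]|noG].
    by exists g.
  have /av_le : power_avoiding k G G^#.
    apply/power_avoidingP; split=> [|g Gg G1g]; first exact: subsetDl.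
    by apply: contraNN noG => /setD1P[gk _]; apply/exists_inP; exists g.
  by rewrite -(leq_add2r 2) eqG (cardsD1 1 G) group1 addnC ltnn.
have G_gt1 : 2 <= #|G|.
  have <- : #|[set 1; t]| = 2 by rewrite cards2 eq_sym nt1.
  by rewrite subset_leq_card // subUset !sub1set group1.
have cardD u : u \in G -> u != 1 -> #|G :\: [set 1; u]| = (#|G| - 2)%N.
  move=> Gu nu1; rewrite cardsDS ?cards2 1?eq_sym ?nu1 //.
  by rewrite subUset !sub1set group1.
apply/eqP; rewrite -(subnK G_gt1) eqn_add2r eqn_leq; apply/andP; split.
  apply/bigmax_leqP=> X avX; have [sXG aX] := power_avoidingP _ _ _ avX.
  (* Neither [g] nor [g ^+ k] is 1, and [X] cannot contain both. *)
  have [u [Gu nu1 nXu]] : exists u, [/\ u \in G, u != 1 & u \notin X].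
    case: (boolP (g \in X)) => [/(aX g Gg)|] nX; last by exists g.
    by exists (g ^+ k); rewrite groupX.
  rewrite -(cardD u) // subset_leq_card //; apply/subsetP=> x Xx.
  rewrite !inE (subsetP sXG) // andbT.
  by apply/norP; split; apply: contraTneq Xx => ->; rewrite ?nXu ?not1.
rewrite -(cardD t) //; apply/av_le/power_avoidingP.
split=> [|h Gh]; first exact: subsetDl.
by rewrite !(in_setD G [set 1; t]); case: (covt h Gh) => ->.
Qed.

Lemma expg_odd_involution (gT : finGroupType) (t : gT) (n : nat) :
  odd n -> t ^+ 2 = 1 -> t ^+ n = t.
Proof.
move=> n_odd t2.
by rewrite -(odd_double_half n) n_odd expgD -mul2n expgM t2 expg1n mulg1.
Qed.

(** * Structure of the group, by the order of t *)

Section OddPrime.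

Variables (gT : finGroupType) (G : {group gT}) (p : nat).
Hypotheses (p_prime : prime p) (p_odd : odd p).

Lemma power_cover_kill (t : gT) : t \in G^# -> power_cover p G t ->
  t ^+ p = 1 -> {in G, forall g, g ^+ p = 1}.
Proof.
move=> /setD1P[nt1 Gt] covt tp g Gg; apply/eqP/negPn/negP=> ngp.
have gp : g ^+ p = t.
  case: (covt g Gg); rewrite !inE ?(negPf ngp) /=; last by move/eqP.
  by move=> /pred2P[] eg; move: ngp; rewrite eg ?expg1n ?tp eqxx.
have ot : #[t] = p := nt_prime_order p_prime tp nt1.
have nt2 : t ^+ 2 != 1.
  rewrite -order_dvdn ot dvdn_prime2 //.
  by apply: contraTneq p_odd => ->.
have g2p : (g ^+ 2) ^+ p = t ^+ 2 by rewrite -gp -!expgM mulnC.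
(* If [g ^+ 2] were 1 or [t], its p-th power [t ^+ 2] would be 1; if [t ^+ 2] were [t], then [t]
   would be 1. *)
case: (covt (g ^+ 2)); rewrite ?groupX // !inE ?g2p => /pred2P[] e.
- by move: nt2; rewrite -g2p e expg1n eqxx.
- by move: nt2; rewrite -g2p e tp eqxx.
- by rewrite e eqxx in nt2.
by move: nt1; rewrite -(inj_eq (mulgI t)) mulg1 -expg2 e eqxx.
Qed.

Lemma power_cover_order (t : gT) : t \in G -> power_cover p G t ->
  t ^+ p != 1 -> t ^+ 2 = 1 \/ t ^+ 3 = 1 /\ t ^+ p = t^-1.
Proof.
move=> Gt covt ntp.
have nt1 : t != 1 by apply: contraNneq ntp => ->; rewrite expg1n.
have [tV | ntV] := eqVneq t^-1 t; first by left; rewrite expg2 -{1}tV mulVg.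
have tp : t ^+ p = t^-1.
  case: (covt t^-1); rewrite ?groupV // !inE ?invg_eq1 ?(negPf nt1) ?(negPf ntV) //=.
  by rewrite expVgn invg_eq1 (negPf ntp) /= => /eqP {2}<-; rewrite invgK.
have nt2 : t ^+ 2 != 1.
  by rewrite expg2 -eq_invg_mul.
(* The p-th power of [t ^+ 2] is t^-2, which must be [t]. *)
right; split=> //; case: (covt (t ^+ 2)); rewrite ?groupX // !inE.
  rewrite (negPf nt2) /= => /eqP/(canRL (mulKg t)); rewrite mulVg => t1.
  by rewrite t1 eqxx in nt1.
rewrite -expgM mulnC expgM tp expVgn invg_eq1 (negPf nt2) /= => /eqP t2V.
by rewrite (expgSr t 2) -{2}t2V mulgV.
Qed.

Lemma power_cover_order3 (t : gT) : t \in G^# -> power_cover p G t ->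
  t ^+ 3 = 1 -> t ^+ p = t^-1 -> G :=: <[t]>.
Proof.
move=> /setD1P[nt1 Gt] covt t3 tp.
have ot : #[t] = 3 by apply: nt_prime_order.
have nt2 : t != t^-1.
  by rewrite eq_sym eq_invg_mul -expg2 -order_dvdn ot.
(* If g^p is not 1 and [g] is not [t], then g^p = t. The p-th power of g^-1 is then t^-1, outside
   {1, t}, so g^-1 itself is [t]. *)
have not_killed g : g \in G -> g ^+ p != 1 -> g \in [set t; t^-1].
  move=> Gg ngp; have ng1 : g != 1 by apply: contraNneq ngp => ->; rewrite expg1n.
  rewrite !inE; case: eqP => //= /eqP ngt.
  have gp : g ^+ p = t.
    by case: (covt g Gg); rewrite !inE ?(negPf ng1) ?(negPf ngt) ?(negPf ngp) //= => /eqP.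
  case: (covt g^-1); rewrite ?groupV // !inE ?invg_eq1 ?(negPf ng1) //=.
    by move=> /eqP <-; rewrite invgK.
  by rewrite expVgn gp invg_eq1 (negPf nt1) eq_sym (negPf nt2).
apply/eqP; rewrite eqEsubset cycle_subG Gt andbT; apply/subsetP=> g Gg.
have inT x : x \in [set t; t^-1] -> x \in <[t]>.
  by rewrite !inE => /pred2P[] ->; rewrite ?groupV cycle_id.
have [gp | /(not_killed g Gg)/inT //] := eqVneq (g ^+ p) 1.
(* Conjugation by [g] sends [t] to [t] or t^-1, so applying it twice fixes [t]. *)
have cg2 : commute t (g ^+ 2).
  have : t ^ g \in [set t; t^-1].
    apply: not_killed; rewrite ?groupJ //.
    by rewrite -conjXg conjg_eq1 tp invg_eq1.
  rewrite !inE => tg; apply/commgP/conjg_fixP; rewrite expg2 conjgM.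
  by case/pred2P: tg => tg; rewrite tg ?tg // conjVg tg invgK.
have cg : commute t g.
  (* For odd p, twice [uphalf p] is p + 1, and g^p = 1. *)
  have -> : g = (g ^+ 2) ^+ uphalf p.
    by rewrite -expgM mul2n odd_uphalfK // expgS gp mulg1.
  exact: commuteX.
rewrite -(groupMl _ (cycle_id t)); apply/inT/not_killed; rewrite ?groupM //.
by rewrite expgMn // gp mulg1 tp invg_eq1.
Qed.

Lemma power_cover_order2 (t : gT) : t \in G^# -> power_cover p G t ->
  t ^+ 2 = 1 -> exists2 P : {group gT}, exponent P %| p & <[t]> \x P = G.
Proof.
move=> /setD1P[nt1 Gt] covt t2.
have ot : #[t] = 2 by apply: nt_prime_order.
have tp : t ^+ p = t := expg_odd_involution p_odd t2.
have cov g : g \in G -> g ^+ p \in [set 1; t].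
  move=> Gg; case: (covt g Gg) => //.
  by rewrite !inE => /pred2P[] ->; rewrite ?expg1n ?tp eqxx ?orbT.
have p_neq2 : p != 2 by apply: contraTneq p_odd => ->.
(* A conjugate of [t] is its own p-th power, hence lies in {1, t}. *)
have cGt : G \subset 'C[t].
  apply/subsetP=> g Gg; apply/cent1P/commute_sym/commgP/conjg_fixP.
  have := cov _ (groupJ Gt Gg).
  by rewrite -conjXg tp !inE conjg_eq1 (negPf nt1) => /eqP.
have g2p g : g \in G -> g ^+ p ^+ 2 = 1.
  by move=> /cov; rewrite !inE => /pred2P[] ->; rewrite ?expg1n.
have [P sylP] := Sylow_exists p G.
have [sPG pP _] := and3P sylP.
have [S sylS] := Sylow_exists 2 G.
have [sSG tS _] := and3P sylS.
have sSt : S \subset <[t]>.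
  apply/subsetP=> x Sx; have Gx := subsetP sSG x Sx.
  (* The order of [x] divides 2p and is prime to p. *)
  have x2 : x ^+ 2 = 1.
    apply/eqP; rewrite -order_dvdn -(@Gauss_dvdr _ p).
      by rewrite order_dvdn expgM g2p.
    by apply: pnat_coprime (mem_p_elt tS Sx) _; rewrite p'natE // dvdn_prime2 // eq_sym.
  have := cov x Gx; rewrite (expg_odd_involution p_odd x2) !inE => /pred2P[] ->;
    by rewrite ?group1 ?cycle_id.
have tiPt : <[t]> :&: P = 1.
  apply: coprime_TIg; rewrite -orderE ot coprime_sym.
  by apply: pnat_coprime pP _; rewrite p'natE // dvdn_prime2.
exists P.
  apply/exponentP=> x Px; have Gx := subsetP sPG x Px.
  have : x ^+ p \in [set 1; t] := cov x Gx.
  rewrite !inE => /pred2P[] // xp.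
  have : t \in <[t]> :&: P by rewrite inE cycle_id -xp groupX.
  by rewrite tiPt inE (negPf nt1).
rewrite dprodE //; last by rewrite (subset_trans sPG) // cent_cycle.
have nPt : <[t]> \subset 'N(P).
  by rewrite cents_norm // cycle_subG (subsetP (centS sPG)) // -sub_cent1.
rewrite -norm_joinEl //; apply/eqP.
rewrite eqEcard join_subG cycle_subG Gt sPG /= norm_joinEl // TI_cardMg //.
(* All orders divide 2p, so by Cauchy only 2 and p can divide |G|, and its odd part is its
   p-part. *)
have <- : (#|G|`_2^')%N = #|P|.
  rewrite (card_Hall sylP); apply: eq_in_partn => q.
  rewrite mem_primes => /and3P[q_pr _ qG].
  have [x Gx ox] := Cauchy q_pr qG.
  have : q %| p * 2 by rewrite -ox order_dvdn expgM g2p.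
  rewrite Euclid_dvdM // !dvdn_prime2 // !inE => /orP[] /eqP->.
    by rewrite p_neq2 eqxx.
  by rewrite [2 == p]eq_sym (negPf p_neq2).
rewrite -{1}(partnC 2 (cardG_gt0 G)) leq_mul2r -(card_Hall sylS).
by rewrite subset_leq_card ?orbT.
Qed.

End OddPrime.

(** * Models of the two families, and the equivalence *)

Lemma isog_Z2X_of_exponent (gT : finGroupType) (G P : {group gT}) (p : nat)
    (t : gT) :
  #[t] = 2 -> exponent P %| p -> <[t]> \x P = G ->
  exists (rT : finGroupType) (E : {group rT}),
    of_exponent p E /\ G \isog setX [set: 'Z_2] E.
Proof.
move=> ot expP defG; exists gT, P; split=> //.
apply: isog_dprod defG (setX_dprod _ _) _ (isog_set1X _ _).
apply: isog_trans (isog_setX1 _ _).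
rewrite isog_cyclic_card ?cycle_cyclic // cardsT card_ord -orderE ot eqxx andbT.
by apply/cyclicP; exists 1%R; rewrite -Zp_cycle.
Qed.

(** In the product, (z, e)^p = (z, 1), so p-th powers take only two values. *)
Lemma Z2X_max_power_avoiding (gT rT : finGroupType) (G : {group gT})
    (E : {group rT}) (p : nat) :
  odd p -> of_exponent p E -> G \isog setX [set: 'Z_2] E ->
  (max_power_avoiding p G + 2 = #|G|)%N.
Proof.
move=> p_odd /exponentP expE; rewrite isog_sym => /isogP[f injf defG].
have domf z e : e \in E -> (z, e) \in setX [set: 'Z_2] E by rewrite !inE.
have fX z e : e \in E -> f (z, e) ^+ p = f (z, 1).
  move=> Ee; rewrite -morphX ?domf //; congr (f _).
  have -> : (z, e) ^+ p = (z ^+ p, e ^+ p) :> _ * _.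
    by elim: p {p_odd expE} => [|n IHn] //; rewrite !expgS IHn.
  rewrite expE //; congr pair.
  apply: expg_odd_involution => //.
  by case: z => -[|[|]] // ?; apply: val_inj.
have f1 : f (1, 1) = 1 by apply: (morph1 f).
(* The group law of ['Z_2] is addition: [1%R] is its involution, while the group identity [1] is
   zero. *)
have Gt : f (1%R, 1) \in G^#.
  rewrite !inE -defG mem_morphim ?domf // andbT -f1.
  by apply/eqP=> /(injmP injf _ _ (domf _ _ (group1 E)) (domf _ _ (group1 E))).
apply/max_power_avoiding_card_sub2P; split; exists (f (1%R, 1)) => //.
  move=> g; rewrite -defG => /morphimP[[z e] _ /setXP[_ Ee] ->]; right.
  rewrite fX // !inE -f1.
  case: z => -[|[|]] // lt; apply/pred2P; [left | right]; congr (f (_, _));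
    exact: val_inj.
by rewrite fX //; have /setD1P[] := Gt.
Qed.

(** As p is 2 modulo 3, the p-th power map inverts, so it swaps [t] and [t ^+ 2]. *)
Lemma Z3_max_power_avoiding (gT : finGroupType) (G : {group gT}) (p : nat) :
  p = 2 %[mod 3] -> G \isog [set: 'Z_3] -> (max_power_avoiding p G + 2 = #|G|)%N.
Proof.
move=> p2 isoG; have cardG : #|G| = 3 by rewrite (card_isog isoG) cardsT card_ord.
have /cyclicP[t defG] : cyclic G by rewrite prime_cyclic // cardG.
have ot : #[t] = 3 by rewrite orderE -defG.
have tX n : t ^+ n = t ^+ (n %% 3) by rewrite -ot expg_mod_order.
have nt n : t ^+ n == 1 = (3 %| n) by rewrite -order_dvdn ot.
apply/max_power_avoiding_card_sub2P; split; exists t.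
- by rewrite !inE defG cycle_id -[t]expg1 nt.
- move=> g; rewrite defG => /cycleP[n ->].
  rewrite !inE -expgM tX (tX (n * p)%N) -modnMm p2.
  by case: (n %% 3) (ltn_pmod n (isT : 0 < 3)) => [|[|[|]]] // _;
    rewrite ?eqxx ?orbT; [left | left | right].
- by rewrite !inE defG cycle_id -[t]expg1 nt.
by rewrite tX p2 nt.
Qed.

Theorem corollary9 (gT : finGroupType) (G : {group gT}) (p : nat)
    (p_prime : prime p) (p_odd : odd p) :
  (max_power_avoiding p G + 2 = #|G|)%N <->
    (exists (rT : finGroupType) (E : {group rT}),
        of_exponent p E /\ G \isog setX [set: 'Z_2] E)
    \/ (p = 2 %[mod 3] /\ G \isog [set: 'Z_3]).
Proof.
split=> [/max_power_avoiding_card_sub2P[[t G1t covt] [g /setD1P[_ Gg] ngp]] |].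
  have [nt1 Gt] := setD1P G1t.
  have ntp : t ^+ p != 1.
    apply: contraNneq ngp => tp.
    by rewrite (power_cover_kill p_prime p_odd G1t covt tp).
  have [t2 | [t3 tp]] := power_cover_order Gt covt ntp; [left | right].
    have [P expP defG] := power_cover_order2 p_prime p_odd G1t covt t2.
    exact: isog_Z2X_of_exponent (nt_prime_order _ t2 nt1) expP defG.
  have ot : #[t] = 3 by apply: nt_prime_order.
  split.
    (* The congruence modulo 3, the order of [t], amounts to t^p = t^2, that is, t^-1 = t^2. *)
    apply/eqP; rewrite -ot -eq_expg_mod_order tp eq_invg_mul.
    by rewrite -expgS t3.
  rewrite (power_cover_order3 p_odd G1t covt t3 tp).
  rewrite isog_cyclic_card ?cycle_cyclic // cardsT card_ord -orderE ot andbT.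
  by apply/cyclicP; exists 1%R; rewrite -Zp_cycle.
case=> [[rT [E [expE isoG]]] | [p2 isoG]].
  exact: Z2X_max_power_avoiding isoG.
exact: Z3_max_power_avoiding.
Qed.
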